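(* Let $k,l,n$ be integers such that $k\geq 2$, $0\leq l\leq k-2$ and $n\geq 1$. The $(k,l)$-extended Motzkin paths of length $n$ are in bijection with the $(k,l)$-threshold sequences of length $n$. Thus they are counted by the Raney number $$R_n^{(k,l+1)}=\frac{l+1}{kn+l+1}\binom{kn+l+1}{n}.$$
   Context: A $(k,l)$-extended Motzkin path of length $n$ is a path on the integral lattice $\mathbb{Z}\times\mathbb{Z}$ never going below the $x$-axis, starting in position $(0,0)$ and ending in position $(n,h)$ for some $0\leq h\leq l$, whose $n$ steps are of three types: up steps $(1,u)$ with $u\geq 1$ an integer, horizontal steps $(1,0)$, and down steps $(1,-t)$ with $1\leq t\leq k-1$ an integer. Here a step $(a,b)$ moves $a$ units to the right and $b$ units up from the current position. A $(k,l)$-threshold sequence of length $n$ is a strictly increasing sequence $S=(s_1s_2\ldots s_n)$ of integers such that $ki\leq s_i\leq kn+l$ for all $1\le i\le n$. Raney numbers are $R_n^{(k,r)}=\frac{r}{kn+r}\binom{kn+r}{n}$. *)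

(* Defs.v *)
From mathcomp Require Import all_boot all_order all_algebra finmap.
From mathcomp Require Import boolp classical_sets functions cardinality.

Set Implicit Arguments.
Unset Strict Implicit.
Unset Printing Implicit Defensive.

Import Order.TTheory GRing.Theory Num.Theory.
Local Open Scope ring_scope.

Definition up_step (s : int * int) : bool := (s.1 == 1) && (1 <= s.2).

Definition horizontal_step (s : int * int) : bool := s == (1, 0).

Definition down_step (k : nat) (s : int * int) : bool :=
  (s.1 == 1) && (1 <= - s.2 <= k%:Z - 1).

(* [q - p] is the coordinatewise difference in Z x Z. *)
Definition motzkin_step (k : nat) (p q : int * int) : bool :=
  [|| up_step (q - p), horizontal_step (q - p) | down_step k (q - p)].

(* A path of length n is encoded by the n lattice points that it visits after
   its starting point (0, 0). *)
Definition ext_motzkin_paths (k l n : nat) : set (n.-tuple (int * int)) :=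
  [set p : n.-tuple (int * int) |
    [/\ path (motzkin_step k) (0, 0) p,
        forall q : int * int, q \in p -> 0 <= q.2
      & exists2 h : int, 0 <= h <= l%:Z & last (0, 0) p = (n%:Z, h)]]%classic.
Arguments ext_motzkin_paths : clear implicits.

(* Tuples are indexed from 0, so s_i is [tnth s] at index i - 1. *)
Definition threshold_seqs (k l n : nat) : set (n.-tuple int) :=
  [set s : n.-tuple int |
    sorted <%R s /\
    forall i : 'I_n, (k * i.+1)%N%:Z <= tnth s i <= (k * n + l)%N%:Z]%classic.
Arguments threshold_seqs : clear implicits.

Definition raney (k r n : nat) : rat :=
  r%:R / (k * n + r)%N%:R * 'C(k * n + r, n)%:R.

(* Main.v *)
(* The shear (i, y) |-> (i, y + k i) turns the heights of a path into a
   threshold sequence: a step of height at least 1 - k becomes a strict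
   increase, nonnegativity becomes s_i >= k i, and the bound on the final
   height becomes s_n <= k n + l.  Splitting on whether the largest allowed
   value m is attained, the number T(m, n) of threshold sequences bounded by m
   satisfies T(m, n) = T(m - 1, n) + T(m - 1, n - 1), as does
   C(m + 1, n) - k C(m, n - 1); both vanish at m = k n - 1. *)

Require Import Defs.
From mathcomp Require Import all_boot all_order all_algebra finmap.
From mathcomp Require Import boolp classical_sets functions cardinality.
From mathcomp Require Import zify ring.

Set Implicit Arguments.
Unset Strict Implicit.
Unset Printing Implicit Defensive.

Import Order.TTheory GRing.Theory Num.Theory.

Section Threshold.

Local Open Scope ring_scope.

(** * Enumeration of threshold sequences by their largest allowed value *)

Variable k : nat.

(** The bound [b] is decoupled from [n], because removing a last entry [x] leaves the bound
    [x - 1]. *)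
Definition bounded_threshold n (b : int) (s : n.-tuple int) : bool :=
  sorted <%R s && [forall i : 'I_n, (k * i.+1)%N%:Z <= tnth s i <= b].

Lemma threshold_seqsE l n (s : n.-tuple int) :
  threshold_seqs k l n s <-> bounded_threshold (k * n + l)%N%:Z s.
Proof.
split=> [[s_inc s_bnd]|/andP[s_inc /forallP s_bnd]]; last by split.
by rewrite /bounded_threshold s_inc; apply/forallP.
Qed.

(** Over the integers, lying strictly below the last entry [x] means being at most [x - 1]. *)
Lemma bounded_threshold_rcons n b (s : n.-tuple int) (x : int) :
  bounded_threshold b (rcons_tuple s x) =
  bounded_threshold (x - 1) s && ((k * n.+1)%N%:Z <= x <= b).
Proof.
rewrite /bounded_threshold !(sorted_pairwise lt_trans) /= pairwise_rcons.
have tnth_old (i : 'I_n) :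
    tnth (rcons_tuple s x) (widen_ord (leqnSn n) i) = tnth s i.
  by rewrite !(tnth_nth 0) /= nth_rcons size_tuple ltn_ord.
have tnth_new : tnth (rcons_tuple s x) ord_max = x.
  by rewrite !(tnth_nth 0) /= nth_rcons size_tuple ltnn eqxx.
apply/idP/idP.
- move=> /andP[/andP[/all_tnthP s_lt s_inc] /forallP s_bnd].
  have x_bnd := s_bnd ord_max; rewrite tnth_new in x_bnd.
  rewrite s_inc x_bnd andbT /=; apply/forallP=> i.
  have := s_bnd (widen_ord (leqnSn n) i); rewrite tnth_old => /andP[-> _] /=.
  by have := s_lt i; lia.
- move=> /andP[/andP[s_inc /forallP s_bnd] x_bnd].
  rewrite s_inc andbT; apply/andP; split.
    by apply/all_tnthP=> i; have := s_bnd i; lia.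
  apply/forallP=> i; have [lt_in|le_ni] := ltnP i n.
    have -> : i = widen_ord (leqnSn n) (Ordinal lt_in) by apply: val_inj.
    rewrite tnth_old; have /andP[] := s_bnd (Ordinal lt_in).
    by move=> /= -> ?; lia.
  have -> : i = ord_max by apply: val_inj => /=; have := ltn_ord i; lia.
  by rewrite tnth_new.
Qed.

(** Duplicate-free list behind [T(m, n)] when [k] is positive: first the sequences bounded by
    [m - 1], then those ending in [m]. The test is the lower bound on the last entry. *)
Fixpoint thresholds (m n : nat) : seq (n.-tuple int) :=
  match n, m with
  | 0, _ => [:: [tuple]]
  | n'.+1, 0 => [::]
  | n'.+1, m'.+1 =>
      thresholds m' n'.+1 ++
      (if (k * n'.+1 <= m'.+1)%N
       then [seq rcons_tuple s m'.+1%:Z | s <- thresholds m' n'] else [::])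
  end.

Lemma rcons_tuple_inj n (x y : int) (s t : n.-tuple int) :
  rcons_tuple s x = rcons_tuple t y -> s = t /\ x = y.
Proof. by move=> /(congr1 val)/rcons_inj[/val_inj-> ->]. Qed.

Lemma tuple_rcons n (t : n.+1.-tuple int) :
  exists s : n.-tuple int, exists x, t = rcons_tuple s x.
Proof.
case: t => t; case/lastP: t => [//|s x] sz_t.
have sz_s : size s == n by rewrite size_rcons eqSS in sz_t.
by exists (Tuple sz_s), x; apply: val_inj.
Qed.

Lemma mem_thresholds m n (s : n.-tuple int) : (0 < k)%N ->
  (s \in thresholds m n) = bounded_threshold m%:Z s.
Proof.
move=> k_gt0; elim: m n s => [|m IHm] [|n] s.
- by rewrite tuple0 mem_head; apply/esym/andP; split=> //; apply/forallP=> -[].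
- have [u [x ->]] := tuple_rcons s; rewrite bounded_threshold_rcons in_nil.
  (* A last entry would satisfy [k (n + 1) <= x <= 0], impossible for positive [k]. *)
  by apply/esym/negbTE/negP => /andP[_]; nia.
- by rewrite tuple0 mem_head; apply/esym/andP; split=> //; apply/forallP=> -[].
have [u [x ->]] := tuple_rcons s.
rewrite bounded_threshold_rcons /= mem_cat IHm bounded_threshold_rcons.
have -> : (rcons_tuple u x \in
    if (k * n.+1 <= m.+1)%N
    then [seq rcons_tuple v m.+1%:Z | v <- thresholds m n] else [::]) =
    [&& x == m.+1%:Z, (k * n.+1)%N%:Z <= x & bounded_threshold (x - 1) u].
  apply/idP/and3P.
    case: ifP => // le_m /mapP[v v_in /rcons_tuple_inj[-> ->]].
    split; [exact: eqxx|lia|].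
    by rewrite -[m.+1]addn1 PoszD addrK -IHm.
  case=> /eqP -> le_m u_thr; have -> : (k * n.+1 <= m.+1)%N by lia.
  apply/mapP; exists u => //; rewrite IHm.
  by rewrite -[m%:Z](addrK 1) -PoszD addn1.
by case: (bounded_threshold (x - 1) u) => /=; lia.
Qed.

Lemma uniq_thresholds m n : (0 < k)%N -> uniq (thresholds m n).
Proof.
move=> k_gt0; elim: m n => [|m IHm] [|n] //=.
rewrite cat_uniq IHm /=; case: ifP => //= _.
apply/andP; split; last first.
  by rewrite map_inj_uniq // => s t /rcons_tuple_inj[].
(* The second part ends in [m + 1], above the bound [m] of the first. *)
apply/hasPn=> _ /mapP[s _ ->]; rewrite /= mem_thresholds //.
by rewrite bounded_threshold_rcons; apply/negP; lia.
Qed.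

(** * Counting by Pascal's rule *)

Lemma thresholds_nil m n : (m < k * n.+1)%N -> thresholds m n.+1 = [::].
Proof.
elim: m => // m IHm lt_m /=; rewrite (IHm (ltnW lt_m)).
by rewrite leqNgt lt_m.
Qed.

(* Equivalent to the closed form [(m + 1 - k n) / (m + 1) * 'C(m + 1, n)], but
   stated so that Pascal's rule applies directly. *)
Lemma size_thresholds m n : (0 < k)%N -> (k * n <= m.+1)%N ->
  (size (thresholds m n) + k * (if n is n'.+1 then 'C(m, n') else 0) =
   'C(m.+1, n))%N.
Proof.
move=> k_gt0; elim: m n => [|m IHm] [|n] le_m; rewrite ?bin0 ?muln0 //=.
  have -> : n = 0%N by nia.
  by have -> : k = 1%N by nia.
rewrite size_cat; case: ifP => [le_kn|/negbT le_kn]; last first.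
  rewrite thresholds_nil /=; last by lia.
  (* On this boundary no sequence exists, and the absorption identity
     [(n+1) C(m+2, n+1) = (m+2) C(m+1, n)] gives [C(m+2, n+1) = k C(m+1, n)]. *)
  have def_m : (m.+2 = k * n.+1)%N by lia.
  apply/eqP; rewrite -(eqn_pmul2l (ltn0Sn n)) -mul_bin_diag /= def_m.
  by apply/eqP; ring.
rewrite size_map.
have := IHm n.+1 le_kn; have := IHm n; rewrite [X in _ -> X]/=.
have -> : (k * n <= m.+1)%N by nia.
move=> /(_ isT); rewrite (binS m.+1).
(* Pascal's rule also splits the binomial multiplied by [k]; for [n = 0] that binomial is 1. *)
by case: n {IHm le_m le_kn} => [|n]; rewrite ?bin0 ?(binS m n) ?mulnDr; lia.
Qed.

(** Put [M = k n + l]. As [(M+1) C(M, n-1) = n C(M+1, n)], multiplying the hypothesis by [M + 1]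
    leaves the factor [M + 1 - k n = l + 1]. *)
Lemma raney_count l n (c : nat) : (0 < n)%N ->
  (c + k * 'C(k * n + l, n.-1) = 'C((k * n + l).+1, n))%N ->
  c%:R = raney k (l + 1) n.
Proof.
case: n => [//|n] _ /=; set M := (k * n.+1 + l)%N => def_c.
rewrite /raney addn1 addnS -/M.
have nzM : (M.+1)%:R != 0 :> rat by rewrite pnatr_eq0.
apply: (mulfI nzM); rewrite mulrA [_ * (_ / _)]mulrC mulfVK // -!natrM.
(* Adding the term to both sides avoids truncated subtraction. *)
congr _%:R; apply/eqP; rewrite -(eqn_add2r (k * (M.+1 * 'C(M, n)))).
have := mul_bin_diag M.+1 n; rewrite /= => diag.
rewrite {2}diag mulnCA -mulnDr def_c; apply/eqP.
by rewrite /M; ring.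
Qed.

(** * The shear between paths and sequences *)

Definition motzkin_of n (s : n.-tuple int) : n.-tuple (int * int) :=
  [tuple (i.+1%:Z, tnth s i - (k * i.+1)%N%:Z) | i < n].

(** Abscissae are forgotten; on a path they are recovered because every step moves one unit
    right. *)
Definition threshold_of n (p : n.-tuple (int * int)) : n.-tuple int :=
  [tuple (tnth p i).2 + (k * i.+1)%N%:Z | i < n].

Lemma motzkin_ofK n : cancel (@motzkin_of n) (@threshold_of n).
Proof. by move=> s; apply: eq_from_tnth => i; rewrite !tnth_mktuple subrK. Qed.

(** A virtual entry [s_0 = 0] matches the starting point, so the first step is treated like the
    others. *)
Lemma nth_motzkin_of n (s : n.-tuple int) i : (i <= n)%N ->
  nth (0, 0) ((0, 0) :: motzkin_of s) i =
  (i%:Z, nth 0 (0 :: s) i - (k * i)%N%:Z).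
Proof.
case: i => [|i] lt_in /=; first by rewrite muln0 subr0.
have := tnth_nth (0, 0) (motzkin_of s) (Ordinal lt_in).
by rewrite tnth_mktuple (tnth_nth 0) => <-.
Qed.

(** The three kinds of step together allow exactly the height changes [y - x - k >= 1 - k]. *)
Lemma motzkin_step_threshold i (x y : int) : (0 < k)%N ->
  motzkin_step k (i%:Z, x - (k * i)%N%:Z) (i.+1%:Z, y - (k * i.+1)%N%:Z) =
  (x < y).
Proof.
move=> k_gt0; rewrite /motzkin_step /up_step /horizontal_step /down_step.
rewrite -[(_ - _)]/(i.+1%:Z - i%:Z, y - (k * i.+1)%N%:Z - (x - (k * i)%N%:Z)).
by rewrite xpair_eqE /= mulnS; lia.
Qed.

Lemma path_motzkin_of n (s : n.-tuple int) : (0 < k)%N ->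
  path (motzkin_step k) (0, 0) (motzkin_of s) = path <%R 0 s.
Proof.
move=> k_gt0.
have step i : (i < n)%N ->
    motzkin_step k (nth (0, 0) ((0, 0) :: motzkin_of s) i)
      (nth (0, 0) (motzkin_of s) i) = (nth 0 (0 :: s) i < nth 0 s i).
  move=> lt_in; have := nth_motzkin_of s lt_in; rewrite /= => ->.
  by rewrite nth_motzkin_of ?(ltnW lt_in) // motzkin_step_threshold.
by apply/(pathP (0, 0))/(pathP 0) => H i; rewrite size_tuple => lt_in;
  have := H i; rewrite size_tuple step //; apply.
Qed.

Lemma motzkin_path_abscissa n (p : n.-tuple (int * int)) :
  path (motzkin_step k) (0, 0) p ->
  forall i : 'I_n, (tnth p i).1 = i.+1%:Z.
Proof.
move=> /(pathP (0, 0)) p_path i; rewrite (tnth_nth (0, 0)).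
have step1 (x y : int * int) : motzkin_step k x y -> y.1 = x.1 + 1.
  case: x y => [x1 x2] [y1 y2].
  rewrite /motzkin_step /up_step /horizontal_step /down_step.
  by rewrite -[(_ - _)]/(y1 - x1, y2 - x2) xpair_eqE /=; lia.
case: i => i /=; elim: i => [|i IHi] lt_in;
  have := p_path _ (etrans (congr1 _ (size_tuple p)) lt_in) => /step1 -> //=.
by rewrite IHi ?(ltnW lt_in) //; lia.
Qed.

Lemma threshold_ofK n (p : n.-tuple (int * int)) :
  path (motzkin_step k) (0, 0) p -> motzkin_of (threshold_of p) = p.
Proof.
move=> /motzkin_path_abscissa p_abs; apply: eq_from_tnth => i.
by rewrite !tnth_mktuple addrK -p_abs -surjective_pairing.
Qed.

Lemma ext_motzkin_paths_of l n (s : n.-tuple int) : (0 < k)%N -> (0 < n)%N ->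
  ext_motzkin_paths k l n (motzkin_of s) <-> threshold_seqs k l n s.
Proof.
case: n s => [//|n] s k_gt0 _.
have last_of : last (0, 0) (motzkin_of s) =
    (n.+1%:Z, tnth s ord_max - (k * n.+1)%N%:Z).
  rewrite (last_nth (0, 0)) size_tuple nth_motzkin_of //.
  by rewrite (tnth_nth 0).
split.
- case; rewrite path_motzkin_of // => /path_sorted s_inc s_ge0 [h h_bnd].
  rewrite last_of => -[def_h]; split=> // i; apply/andP; split.
    have /s_ge0 := mem_tnth i (motzkin_of s).
    by rewrite tnth_mktuple subr_ge0.
  (* The final height bounds only the last entry; monotonicity passes the bound on to the others. *)
  have : tnth s i <= tnth s ord_max.
    rewrite !(tnth_nth 0); apply: sorted_leq_nth => //.
    - exact: le_trans.
    - by apply: sub_sorted s_inc => x y /ltW.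
    - by rewrite inE size_tuple.
    - by rewrite inE size_tuple.
    - by rewrite -ltnS.
  by lia.
- case=> s_inc s_bnd; split.
  + rewrite path_motzkin_of // path_min_sorted //.
    apply/all_tnthP => i; have /andP[s_ge _] := s_bnd i.
    by apply: lt_le_trans s_ge; rewrite ltz_nat muln_gt0 k_gt0.
  + move=> _ /tnthP[i ->]; rewrite tnth_mktuple subr_ge0.
    by have /andP[] := s_bnd i.
  + exists (tnth s ord_max - (k * n.+1)%N%:Z) => //.
    by have := s_bnd ord_max; rewrite /=; lia.
Qed.

Lemma ext_motzkin_pathsE l n : (0 < k)%N -> (0 < n)%N ->
  ext_motzkin_paths k l n =
  [set` [seq motzkin_of s | s <- thresholds (k * n + l) n]]%classic.
Proof.
move=> k_gt0 n_gt0; apply/seteqP; split=> p /=.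
- move=> p_path; have [/threshold_ofK def_p _ _] := p_path.
  rewrite -def_p in p_path *; apply: map_f; rewrite mem_thresholds //.
  by apply/threshold_seqsE/ext_motzkin_paths_of.
- move=> /mapP[s s_in ->]; apply/ext_motzkin_paths_of => //.
  by apply/threshold_seqsE; rewrite -mem_thresholds.
Qed.

End Threshold.

Theorem corollary5p4 (k l n : nat) (hk : (2 <= k)%N) (hl : (l <= k - 2)%N)
    (hn : (1 <= n)%N) :
  (exists f : n.-tuple (int * int) -> n.-tuple int,
      set_bij (ext_motzkin_paths k l n) (threshold_seqs k l n) f) /\
  finite_set (ext_motzkin_paths k l n) /\
  ((#|` fset_set (ext_motzkin_paths k l n)|)%fset%:R = raney k (l + 1) n)%R.
Proof.
have k_gt0 : 0 < k by apply: ltnW.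
split; last split.
- exists (@threshold_of k n); split.
  + move=> p p_path; have [/threshold_ofK def_p _ _] := p_path.
    by apply/ext_motzkin_paths_of => //; rewrite def_p.
  + move=> p q /set_mem[/threshold_ofK def_p _ _].
    move=> /set_mem[/threshold_ofK def_q _ _].
    by move=> eq_pq; rewrite -def_p eq_pq.
  + move=> s s_thr; exists (motzkin_of k s); last exact: motzkin_ofK.
    exact/ext_motzkin_paths_of.
- by rewrite ext_motzkin_pathsE //; apply/finite_seqP; eexists.
- rewrite ext_motzkin_pathsE //.
  set t := [seq _ | _ <- _]%SEQ.
  (* Passing to a finite set reduces the cardinality to the length of a duplicate-free list. *)
  have -> : [set` t]%classic = [set` [fset x in t]%fset]%classic.
    by apply/seteqP; split=> x /=; rewrite inE.
  rewrite set_fsetK card_fseq undup_id; last first.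
    by rewrite map_inj_uniq ?uniq_thresholds //; apply: can_inj (@motzkin_ofK k n).
  rewrite size_map; apply: raney_count => //.
  have := @size_thresholds k (k * n + l) n k_gt0.
  by case: n hn {t} => // n _; apply; rewrite -addnS leq_addr.
Qed.
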